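(* Let $n\in\mathbb{N}\cup\{0\}$, let $a,b\in\mathbb{R}$ with $a<b$ and let $\lambda_n:=\frac{2\tau_n}{b-a}$. Then, for all $f\in\mathscr{C}^2_{\mathbb{K}}([a,b])$, the quantity $$E:=\bigg|\frac{f(a)+f(b)}{2}-\frac{1}{b-a}\int_a^bf(x)\,dx\bigg|$$ satisfies the following estimates. If $n=0$, then $$E\leq\frac{1}{12}(b-a)^2\cdot\|f''\|_\infty\qquad\text{and}\qquad E\leq\frac18(b-a)\cdot\|f''\|_1.$$ If $n>0$, then $$E\leq\frac{(n+1)n\pi}{2\tau_n^3}(b-a)^2\cdot\|f''+\lambda_n^2f\|_\infty\qquad\text{and}\qquad E\leq\frac{1+|\cos(\tau_n)|}{4\tau_n|\sin(\tau_n)|}(b-a)\cdot\|f''+\lambda_n^2f\|_1.$$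
   Context: $\mathbb{K}$ is $\mathbb{R}$ or $\mathbb{C}$, and $\mathscr{C}^2_{\mathbb{K}}([a,b])$ is the space of twice continuously differentiable $\mathbb{K}$-valued functions on $[a,b]$. For an integer $m$, $\tau_m$ denotes the unique fixed point of the tangent function (i.e. the unique $v$ with $\tan v=v$) in the open interval $\big((m-\frac12)\pi,(m+\frac12)\pi\big)$. The norms are $\|h\|_1=\int_a^b|h(t)|\,dt$ and $\|h\|_\infty$, the (essential) supremum of $|h|$ on $[a,b]$. *)

(* Defs.v *)
From Stdlib Require Import Reals ZArith Lra Lia.
From Coquelicot Require Import Coquelicot.

Open Scope R_scope.

(* The two scalar fields, seen as real Banach spaces; the norm is the absolute
   value on R and the modulus on C (see norm_RealField, norm_ComplexField). *)
Inductive RorC := RealField | ComplexField.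

Definition scalars (K : RorC) : CompleteNormedModule R_AbsRing :=
  match K with
  | RealField => R_CompleteNormedModule
  | ComplexField => C_R_CompleteNormedModule
  end.

Lemma norm_RealField (x : scalars RealField) : norm x = Rabs x.
Proof. reflexivity. Qed.

Lemma norm_ComplexField (z : scalars ComplexField) : norm z = Cmod z.
Proof.
change (sqrt (Rabs (fst z) ^ 2 + Rabs (snd z) ^ 2) = Cmod z).
unfold Cmod. now rewrite !pow2_abs.
Qed.

Lemma minus_split {G : AbelianGroup} (g u v : G) :
  minus v u = plus (minus g u) (opp (minus g v)).
Proof.
rewrite opp_minus, (plus_comm (minus g u)).
apply minus_trans.
Qed.

Lemma scal_minus_split {K : Ring} {W : ModuleSpace K} (h : K) (g l m : W) :
  scal h (minus m l) = plus (minus g (scal h l)) (opp (minus g (scal h m))).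
Proof.
exact (eq_trans (scal_minus_distr_l h m l) (minus_split g (scal h l) (scal h m))).
Qed.

Lemma slope_bound {W : NormedModule R_AbsRing} (h : R) (g l m : W) (e : R) :
  h <> 0 ->
  norm (minus g (scal h l)) <= e * Rabs h ->
  norm (minus g (scal h m)) <= e * Rabs h ->
  norm (minus m l) <= 2 * e.
Proof.
intros Hh Hl Hm.
assert (Hpos : 0 < Rabs h) by (apply Rabs_pos_lt; exact Hh).
pose proof (norm_triangle (minus g (scal h l)) (opp (minus g (scal h m)))) as H.
pose proof (norm_opp (minus g (scal h m))) as Ho.
pose proof (scal_minus_split h g l m) as Hs.
assert (Hsc : norm (scal h (minus m l)) <= 2 * e * Rabs h).
{ eapply Rle_trans; [apply Req_le, (f_equal norm Hs)|].
  eapply Rle_trans; [exact H|]. rewrite Ho. lra. }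
pose proof (norm_scal (/ h) (scal h (minus m l))) as Hn.
assert (Hi : scal (/ h) (scal h (minus m l)) = minus m l).
{ rewrite scal_assoc.
  replace (mult (/ h) h) with (@one R_AbsRing)
    by (unfold mult, one; simpl; field; exact Hh).
  apply scal_one. }
eapply Rle_trans; [apply Req_le, (f_equal norm (eq_sym Hi))|].
eapply Rle_trans; [exact Hn|].
change (Rabs (/ h) * norm (scal h (minus m l)) <= 2 * e).
rewrite Rabs_inv.
apply Rmult_le_reg_l with (1 := Hpos).
rewrite <- Rmult_assoc, Rinv_r, Rmult_1_l by lra.
lra.
Qed.

Section OnSegment.

Context {V : CompleteNormedModule R_AbsRing}.

Definition segment (a b : R) : R -> Prop := fun x => a <= x <= b.

(* Derivatives relative to [a, b]: Coquelicot's is_derive with the filter of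
   neighbourhoods of x replaced by its trace on [a, b], so one-sided at a and b
   and insensitive to the values of f outside [a, b]. *)
Definition is_derive_on (a b : R) (f : R -> V) (x : R) (l : V) : Prop :=
  filterdiff f (within (segment a b) (locally x)) (fun h : R => scal h l).

Definition ex_derive_on (a b : R) (f : R -> V) (x : R) : Prop :=
  exists l : V, is_derive_on a b f x l.

Definition Derive_on (a b : R) (f : R -> V) (x : R) : V :=
  iota (is_derive_on a b f x).

Definition Derive2_on (a b : R) (f : R -> V) : R -> V :=
  Derive_on a b (Derive_on a b f).

Definition C2_on (a b : R) (f : R -> V) : Prop :=
  (forall x, segment a b x -> ex_derive_on a b f x) /\
  (forall x, segment a b x -> ex_derive_on a b (Derive_on a b f) x) /\
  continuous_on (segment a b) (Derive2_on a b f).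

Definition norm_L1 (a b : R) (h : R -> V) : R :=
  RInt (fun t => norm (h t)) a b.

(* Used only for continuous h, where the set is bounded and the essential
   supremum is the supremum. *)
Definition norm_sup (a b : R) (h : R -> V) : R :=
  real (Lub_Rbar (fun r => exists t, segment a b t /\ r = norm (h t))).

Lemma is_derive_on_unique (a b : R) (f : R -> V) (x : R) (l : V) :
  a < b -> segment a b x -> is_derive_on a b f x l -> Derive_on a b f x = l.
Proof.
intros Hab Hx Hl.
apply (iota_unique (is_derive_on a b f x)); [|exact Hl].
intros m Hm.
assert (HF : is_filter_lim (within (segment a b) (locally x)) x).
{ intros P HP. unfold within. apply filter_imp with (2 := HP). auto. }
destruct Hl as [_ Hl]; destruct Hm as [_ Hm].
specialize (Hl x HF); specialize (Hm x HF).
assert (Hsmall : forall eps : posreal, norm (minus m l) <= 2 * eps).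
{ intros eps.
  specialize (Hl eps); specialize (Hm eps).
  unfold within in Hl, Hm.
  destruct (filter_and _ _ Hl Hm) as [d Hd].
  assert (Hy : exists y, ball x d y /\ segment a b y /\ y <> x).
  { pose proof (cond_pos d) as Hd0.
    destruct Hx as [Hax Hxb].
    destruct (Rlt_dec x b) as [Hlt|Hge].
    - exists (x + Rmin (d / 2) (b - x)).
      assert (0 < Rmin (d / 2) (b - x)) by (apply Rmin_pos; lra).
      pose proof (Rmin_l (d / 2) (b - x)); pose proof (Rmin_r (d / 2) (b - x)).
      repeat split; try lra.
      change (Rabs (x + Rmin (d / 2) (b - x) - x) < d).
      rewrite Rabs_pos_eq; lra.
    - exists (x - Rmin (d / 2) (x - a)).
      assert (0 < Rmin (d / 2) (x - a)) by (apply Rmin_pos; lra).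
      pose proof (Rmin_l (d / 2) (x - a)); pose proof (Rmin_r (d / 2) (x - a)).
      repeat split; try lra.
      change (Rabs (x - Rmin (d / 2) (x - a) - x) < d).
      rewrite Rabs_left; lra. }
  destruct Hy as [y [Hby [Hsy Hne]]].
  destruct (Hd y Hby) as [H1 H2].
  specialize (H1 Hsy); specialize (H2 Hsy).
  set (h := minus y x) in *.
  set (g := minus (f y) (f x)) in *.
  assert (Hh : h <> 0) by (unfold h, minus, plus, opp; simpl; lra).
  exact (slope_bound h g l m eps Hh H1 H2). }
assert (H0 : norm (minus m l) = 0).
{ apply Rle_antisym; [|apply norm_ge_0].
  apply Rnot_lt_le; intros Hlt.
  assert (Hp : 0 < norm (minus m l) / 4) by lra.
  specialize (Hsmall (mkposreal _ Hp)); simpl in Hsmall. lra. }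
apply norm_eq_zero in H0.
apply (plus_reg_r (opp l)).
exact (eq_trans H0 (eq_sym (plus_opp_r l))).
Qed.

End OnSegment.

Definition is_tan_fixpoint (m : Z) (v : R) : Prop :=
  (IZR m - / 2) * PI < v < (IZR m + / 2) * PI /\ tan v = v.

Definition tau (m : Z) : R := iota (is_tan_fixpoint m).

Lemma cos_neq_0_between (m : Z) (v : R) :
  (IZR m - / 2) * PI < v < (IZR m + / 2) * PI -> cos v <> 0.
Proof.
intros Hv Hc.
destruct (cos_eq_0_0 v Hc) as [k Hk].
pose proof PI_RGT_0.
assert (H1 : IZR (m - 1) < IZR k < IZR m).
{ rewrite minus_IZR. split; apply Rmult_lt_reg_r with PI; lra. }
destruct H1 as [H1 H2]. apply lt_IZR in H1, H2. lia.
Qed.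

Lemma tan_minus_id_lt (m : Z) (u v : R) :
  (IZR m - / 2) * PI < u -> u < v -> v < (IZR m + / 2) * PI ->
  ~ u < IZR m * PI < v -> tan u - u < tan v - v.
Proof.
intros Hu Huv Hv Hm.
pose proof PI_RGT_0.
destruct (MVT_cor2 (fun x => tan x - x) (fun x => (1 + tan x ^ 2) - 1) u v Huv)
  as [c [Hc Hcuv]].
{ intros c Hc. apply is_derive_Reals.
  apply (is_derive_minus tan (fun x => x)); [|exact (is_derive_id (K := R_AbsRing) c)].
  replace (1 + tan c ^ 2) with (tan c ^ 2 + 1) by ring.
  apply is_derive_tan, (cos_neq_0_between m); lra. }
assert (Ht : tan c <> 0).
{ assert (Hcc : cos c <> 0) by (apply (cos_neq_0_between m); lra).
  intros H0. unfold tan in H0.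
  assert (Hs : sin c = 0).
  { apply Rmult_integral in H0. destruct H0 as [H0|H0]; [exact H0|].
    exfalso; revert H0; apply Rinv_neq_0_compat; exact Hcc. }
  destruct (sin_eq_0_0 c Hs) as [k Hk].
  assert (H1 : IZR (m - 1) < IZR k < IZR (m + 1)).
  { rewrite minus_IZR, plus_IZR. split; apply Rmult_lt_reg_r with PI; lra. }
  destruct H1 as [H1 H2]. apply lt_IZR in H1, H2.
  replace k with m in Hk by lia. apply Hm. lra. }
assert (0 < tan c ^ 2) by (apply pow2_gt_0; exact Ht).
nra.
Qed.

Lemma tan_minus_id_incr (m : Z) (u v : R) :
  (IZR m - / 2) * PI < u -> u < v -> v < (IZR m + / 2) * PI ->
  tan u - u < tan v - v.
Proof.
intros Hu Huv Hv.
destruct (Rlt_dec u (IZR m * PI)) as [H1|H1];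
  [destruct (Rlt_dec (IZR m * PI) v) as [H2|H2]|];
  try (apply (tan_minus_id_lt m); lra).
apply Rlt_trans with (tan (IZR m * PI) - IZR m * PI);
  apply (tan_minus_id_lt m); lra.
Qed.

Lemma tau_exists_unique (m : Z) : exists! v, is_tan_fixpoint m v.
Proof.
pose proof PI_RGT_0 as HPI.
set (l := (IZR m - / 2) * PI). set (r := (IZR m + / 2) * PI).
assert (Hlr : l < r) by (unfold l, r; lra).
set (F := fun x => sin x - x * cos x).
assert (Hcl : cos l = 0).
{ apply cos_eq_0_1. exists (m - 1)%Z. unfold l. rewrite minus_IZR. lra. }
assert (Hcr : cos r = 0).
{ apply cos_eq_0_1. exists m. unfold r. lra. }
assert (Hs : sin r = - sin l).
{ replace r with (l + PI) by (unfold l, r; lra). apply neg_sin. }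
assert (Hsl : sin l <> 0).
{ intros H0. pose proof (sin2_cos2 l) as H. rewrite H0, Hcl in H.
  unfold Rsqr in H. lra. }
assert (HFl : F l = sin l) by (unfold F; rewrite Hcl; ring).
assert (HFr : F r = - sin l) by (unfold F; rewrite Hcr, Hs; ring).
assert (HFc : continuity F).
{ unfold F. apply continuity_minus; [apply continuity_sin|].
  apply (continuity_mult (fun x => x) cos);
    [apply derivable_continuous, derivable_id|apply continuity_cos]. }
destruct (IVT_cor F l r HFc) as [v [Hv HFv]]; [lra|rewrite HFl, HFr; nra|].
assert (Hvl : v <> l) by (intros ->; lra).
assert (Hvr : v <> r) by (intros ->; lra).
assert (Hvi : l < v < r) by lra.
assert (Hcv : cos v <> 0) by (apply (cos_neq_0_between m); exact Hvi).
assert (Htv : tan v = v).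
{ unfold F in HFv. unfold tan. apply Rmult_eq_reg_r with (cos v); [|exact Hcv].
  unfold Rdiv. rewrite Rmult_assoc, Rinv_l; lra. }
exists v. split; [split; assumption|].
intros w [Hw Htw]. fold l r in Hw.
destruct (Rtotal_order v w) as [H|[H|H]]; [|exact H|].
- pose proof (tan_minus_id_incr m v w (proj1 Hvi) H (proj2 Hw)). lra.
- pose proof (tan_minus_id_incr m w v (proj1 Hw) H (proj2 Hvi)). lra.
Qed.

Lemma tau_spec (m : Z) : is_tan_fixpoint m (tau m).
Proof.
exact (iota_correct (is_tan_fixpoint m) (tau_exists_unique m)).
Qed.

(* Main.v *)
(** Peano kernel: if k'' + lambda^2 k = - 1/(b-a) with k(a) = k(b) = 0,
    k'(a) = 1/2 and k'(b) = - 1/2, then two integrations by parts give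
    (f(a)+f(b))/2 - mean(f) = int_a^b k (f'' + lambda^2 f), so the two constants
    are int |k| and sup |k|.  For n = 0 the kernel is quadratic; for n > 0 it is
    a multiple of cos(lambda (x - (a+b)/2)) - cos(tau_n), where tan tau_n = tau_n
    is what makes k vanish at the ends with the right slopes.  With
    tau_n = n pi + t, the substitution v = lambda (x - (a+b)/2) + n pi turns |k|
    into a multiple of |cos v - cos t| on [-t, 2 n pi + t], which is integrated
    period by period. *)

Require Import Defs.
From Stdlib Require Import Reals ZArith Lra Lia.
From Coquelicot Require Import Coquelicot.
Open Scope R_scope.

(** * Extension from the segment to the whole line, by projection onto [[a, b]] *)

Definition clamp (a b x : R) : R := Rmax a (Rmin b x).

Lemma clamp_segment (a b x : R) : a <= b -> segment a b (clamp a b x).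
Proof.
intros Hab; unfold segment, clamp.
split; [apply Rmax_l|apply Rmax_lub; [exact Hab|apply Rmin_l]].
Qed.

Lemma clamp_id (a b x : R) : segment a b x -> clamp a b x = x.
Proof.
intros [H1 H2]; unfold clamp. rewrite Rmin_right, Rmax_right; lra.
Qed.

Lemma clamp_left (a b x : R) : a <= b -> x <= a -> clamp a b x = a.
Proof.
intros Hab Hx; unfold clamp. rewrite Rmin_right, Rmax_left; lra.
Qed.

Lemma clamp_right (a b x : R) : a <= b -> b <= x -> clamp a b x = b.
Proof.
intros Hab Hx; unfold clamp. rewrite Rmin_left, Rmax_right; lra.
Qed.

(** The projection onto [[a, b]] is nonexpansive and fixes [x], so a ball around [x] is mapped into
    its trace on the segment; this turns relative limits into two-sided ones. *)
Lemma clamp_dist (a b x y : R) :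
  segment a b x -> Rabs (clamp a b y - x) <= Rabs (y - x).
Proof.
intros [H1 H2].
destruct (Rle_dec y a); [rewrite clamp_left by lra; rewrite !Rabs_left1; lra|].
destruct (Rle_dec b y); [rewrite clamp_right by lra; rewrite !Rabs_pos_eq; lra|].
rewrite clamp_id by (split; lra). apply Rle_refl.
Qed.

Lemma minus_minus_plus {G : AbelianGroup} (u v : G) :
  minus (minus (plus u v) u) v = zero.
Proof.
unfold minus. rewrite (plus_comm u v), <- (plus_assoc v), plus_opp_r, plus_zero_r.
apply plus_opp_r.
Qed.

(** Group bookkeeping for [kernel_combine]: [p] and [q] stand for the halved end values, [u] for the
    term in [L], which cancels, and [v] for the mean of the function. *)
Lemma minus_minus_opp {G : AbelianGroup} (p q u v : G) :
  plus (minus (minus zero zero) (minus (minus (opp q) p) (plus (opp u) (opp v)))) u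
  = minus (plus p q) v.
Proof.
rewrite minus_zero_r. unfold minus.
rewrite plus_zero_l, !(opp_plus (G := G)), !(opp_opp (G := G)).
change (plus (plus (plus q p) (plus (opp u) (opp v))) u = plus (plus p q) (opp v)).
rewrite (plus_comm q p), (plus_comm (opp u)), <- (plus_assoc (plus p q)), <- (plus_assoc (opp v)).
apply (f_equal (plus (plus p q))).
exact (eq_trans (f_equal (plus (opp v)) (plus_opp_l u)) (plus_zero_r (opp v))).
Qed.

Section Extension.

Context {V : CompleteNormedModule R_AbsRing}.

Lemma scal_R0 (u : V) : scal 0 u = zero.
Proof. exact (scal_zero_l u). Qed.

Lemma scal_scal_comm (c d : R) (u : V) : scal c (scal d u) = scal d (scal c u).
Proof.
exact (eq_trans (scal_assoc c d u)
  (eq_trans (f_equal (fun e : R => scal e u) (Rmult_comm c d))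
    (eq_sym (scal_assoc d c u)))).
Qed.

Lemma continuous_clamp (a b : R) (h : R -> V) (x : R) :
  continuous_on (segment a b) h -> segment a b x ->
  continuous (fun y => h (clamp a b y)) x.
Proof.
intros Hh Hx.
unfold continuous. rewrite (clamp_id a b x Hx).
intros P HP. destruct (Hh x Hx P HP) as [d Hd].
exists d. intros y Hy. apply Hd.
- apply Rle_lt_trans with (2 := Hy). apply (clamp_dist a b x y Hx).
- apply clamp_segment. destruct Hx; lra.
Qed.

(* A two-sided differentiable extension of F, so that Coquelicot's integration by
   parts, stated with two-sided derivatives, applies up to the end points. *)
Definition affine_extension (a b : R) (F dF : R -> V) (x : R) : V :=
  plus (F (clamp a b x)) (scal (x - clamp a b x) (dF (clamp a b x))).

Lemma affine_extension_segment (a b : R) (F dF : R -> V) (x : R) :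
  segment a b x -> affine_extension a b F dF x = F x.
Proof.
intros Hx. unfold affine_extension. rewrite (clamp_id a b x Hx), Rminus_diag.
rewrite (scal_R0 (dF x)). apply plus_zero_r.
Qed.

(** Inside the segment the relative derivative applies. Beyond an end point the extension is affine
    with the one-sided derivative there as slope, so the remainder at that end point is exactly
    zero. *)
Lemma is_derive_affine_extension (a b : R) (F dF : R -> V) (x : R) :
  a < b -> (forall t, segment a b t -> is_derive_on a b F t (dF t)) ->
  segment a b x -> is_derive (affine_extension a b F dF) x (dF x).
Proof.
intros Hab HF Hx. split; [apply is_linear_scal_l|].
intros z Hz. apply (is_filter_lim_locally_unique x z) in Hz. subst z.
intros eps.
destruct (HF x Hx) as [_ HFx].
assert (Hlim : is_filter_lim (within (segment a b) (locally x)) x).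
{ intros P HP. unfold within. apply filter_imp with (2 := HP). auto. }
destruct (HFx x Hlim eps) as [d Hd].
(* The radii [da] and [db] ensure that [y] can reach or pass an end point only if [x] is that end
   point; in that case the radius 1 is arbitrary. *)
assert (Hda : exists d1 : posreal, a = x \/ d1 <= x - a).
{ destruct (Rle_lt_or_eq_dec a x (proj1 Hx)) as [H|H].
  - assert (H' : 0 < x - a) by lra. exists (mkposreal _ H'). right; simpl; lra.
  - exists (mkposreal 1 Rlt_0_1). now left. }
assert (Hdb : exists d1 : posreal, b = x \/ d1 <= b - x).
{ destruct (Rle_lt_or_eq_dec x b (proj2 Hx)) as [H|H].
  - assert (H' : 0 < b - x) by lra. exists (mkposreal _ H'). right; simpl; lra.
  - exists (mkposreal 1 Rlt_0_1). left; lra. }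
destruct Hda as [da Hda]. destruct Hdb as [db Hdb].
assert (Hm : 0 < Rmin d (Rmin da db)).
{ repeat apply Rmin_pos; apply cond_pos. }
exists (mkposreal _ Hm). intros y Hy.
change (Rabs (y - x) < Rmin d (Rmin da db)) in Hy.
pose proof (Rmin_l d (Rmin da db)). pose proof (Rmin_r d (Rmin da db)).
pose proof (Rmin_l da db). pose proof (Rmin_r da db).
rewrite (affine_extension_segment a b F dF x Hx).
assert (Hout : clamp a b y = x ->
  norm (minus (minus (affine_extension a b F dF y) (F x))
              (scal (minus y x) (dF x))) <= eps * norm (minus y x)).
{ intros Hc. unfold affine_extension. rewrite Hc.
  assert (Hz : minus (minus (plus (F x) (scal (y - x) (dF x))) (F x))
                 (scal (minus y x) (dF x)) = zero).
  { exact (minus_minus_plus (F x) (scal (y - x) (dF x))). }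
  eapply Rle_trans; [apply Req_le, (f_equal norm Hz)|].
  eapply Rle_trans; [apply Req_le; exact (norm_zero (V := V))|].
  apply Rmult_le_pos; [apply Rlt_le, cond_pos|apply norm_ge_0]. }
destruct (Rle_dec y a) as [Hya|Hya].
{ apply Hout. rewrite clamp_left by lra.
  destruct Hda as [Hda|Hda]; [exact Hda|].
  pose proof (Rcomplements.Rabs_lt_between (y - x) (Rmin d (Rmin da db))) as [Hr _].
  specialize (Hr Hy). lra. }
destruct (Rle_dec b y) as [Hby|Hby].
{ apply Hout. rewrite clamp_right by lra.
  destruct Hdb as [Hdb|Hdb]; [exact Hdb|].
  pose proof (Rcomplements.Rabs_lt_between (y - x) (Rmin d (Rmin da db))) as [Hr _].
  specialize (Hr Hy). lra. }
assert (Hys : segment a b y) by (split; lra).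
rewrite (affine_extension_segment a b F dF y Hys).
apply Hd; [|exact Hys].
change (Rabs (y - x) < d). lra.
Qed.

Lemma Derive_on_correct (a b : R) (F : R -> V) (x : R) :
  a < b -> segment a b x -> ex_derive_on a b F x ->
  is_derive_on a b F x (Derive_on a b F x).
Proof.
intros Hab Hx [l Hl]. now rewrite (is_derive_on_unique a b F x l Hab Hx Hl).
Qed.

(** The function and its derivative are extended affinely, each on its own, so [F1] need not be the
    derivative of [F] off the segment. Integration by parts asks for this only at points of the
    segment. Of [F2] only continuity is required, hence plain clamping. *)
Lemma C2_on_extension (a b : R) (f : R -> V) :
  a < b -> C2_on a b f ->
  exists F F1 F2 : R -> V,
    (forall x, segment a b x ->
       F x = f x /\ F2 x = Derive2_on a b f x /\
       is_derive F x (F1 x) /\ is_derive F1 x (F2 x) /\ continuous F2 x).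
Proof.
intros Hab [Hf [Hf1 Hf2]].
exists (affine_extension a b f (Derive_on a b f)).
exists (affine_extension a b (Derive_on a b f) (Derive2_on a b f)).
exists (fun x => Derive2_on a b f (clamp a b x)).
intros x Hx.
split; [|split; [|split; [|split]]].
- now apply affine_extension_segment.
- now rewrite clamp_id.
- rewrite (affine_extension_segment a b (Derive_on a b f)) by exact Hx.
  apply is_derive_affine_extension; [exact Hab| |exact Hx].
  intros t Ht. apply Derive_on_correct; auto.
- rewrite clamp_id by exact Hx.
  apply is_derive_affine_extension; [exact Hab| |exact Hx].
  intros t Ht. apply Derive_on_correct; auto.
- now apply continuous_clamp.
Qed.

(** * Peano kernel representation of the trapezoidal error *)

Lemma is_derive_continuous (F : R -> V) (x : R) (l : V) :
  is_derive F x l -> continuous F x.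
Proof.
intros H. apply (ex_derive_continuous F x). now exists l.
Qed.

(** The left side is what two integrations by parts produce once the end values 0 of [k] and the
    slopes 1/2 and -1/2 are inserted; [J] is the integral of [k f] and [I] that of [f]. *)
Lemma kernel_combine (L c : R) (u v p q J I : V) :
  plus (minus (minus (scal 0 u) (scal 0 v))
         (minus (minus (scal (- / 2) q) (scal (/ 2) p))
                (plus (scal (- L) J) (scal (- c) I))))
       (scal L J)
  = minus (scal (/ 2) (plus p q)) (scal c I).
Proof.
rewrite !scal_R0.
rewrite (scal_opp_l L J : scal (- L) J = opp (scal L J)).
rewrite (scal_opp_l c I : scal (- c) I = opp (scal c I)).
rewrite (scal_opp_l (/ 2) q : scal (- / 2) q = opp (scal (/ 2) q)).
rewrite (scal_distr_l (/ 2) p q : scal (/ 2) (plus p q) = plus (scal (/ 2) p) (scal (/ 2) q)).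
exact (minus_minus_opp (scal (/ 2) p) (scal (/ 2) q) (scal L J) (scal c I)).
Qed.

(** The parameter [L] serves both cases: 0 for the quadratic kernel and [lambda_n ^ 2] for the
    oscillating one. *)
Lemma kernel_representation (a b L : R) (k k1 : R -> R) (f : R -> V) :
  a < b -> C2_on a b f ->
  (forall x, is_derive k x (k1 x)) ->
  (forall x, is_derive k1 x (- L * k x - / (b - a))) ->
  k a = 0 -> k b = 0 -> k1 a = / 2 -> k1 b = - / 2 ->
  is_RInt (fun x => scal (k x) (plus (Derive2_on a b f x) (scal L (f x)))) a b
    (minus (scal (/ 2) (plus (f a) (f b))) (scal (/ (b - a)) (RInt f a b))).
Proof.
intros Hab Hf Hk Hk1 Hka Hkb Hk1a Hk1b.
destruct (C2_on_extension a b f Hab Hf) as [F [F1 [F2 HF]]].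
assert (Hseg : forall x, Rmin a b <= x <= Rmax a b -> segment a b x).
{ intros x. rewrite Rmin_left, Rmax_right by lra. exact (fun H => H). }
assert (Hseg' : forall x, Rmin a b < x < Rmax a b -> segment a b x).
{ intros x Hx. apply Hseg. lra. }
assert (Ha : segment a b a) by (split; lra).
assert (Hb : segment a b b) by (split; lra).
assert (Ck : forall x, continuous k x).
{ intros x. apply (ex_derive_continuous k x). now exists (k1 x). }
assert (Ck1 : forall x, continuous k1 x).
{ intros x. apply (ex_derive_continuous k1 x). eexists; apply Hk1. }
assert (Ck2 : forall x, continuous (fun x => - L * k x - / (b - a)) x).
{ intros x. apply (continuous_minus (fun x => - L * k x) (fun _ => / (b - a)));
    [|apply continuous_const].
  apply (continuous_scal_r (- L) k), Ck. }
assert (CF : forall x, segment a b x -> continuous F x).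
{ intros x Hx. destruct (HF x Hx) as [_ [_ [H _]]].
  exact (is_derive_continuous F x _ H). }
assert (CF1 : forall x, segment a b x -> continuous F1 x).
{ intros x Hx. destruct (HF x Hx) as [_ [_ [_ [H _]]]].
  exact (is_derive_continuous F1 x _ H). }
destruct (ex_RInt_continuous F a b) as [I HI].
{ intros x Hx. now apply CF, Hseg. }
destruct (ex_RInt_continuous (fun x => scal (k x) (F x)) a b) as [J HJ].
{ intros x Hx. apply (continuous_scal k F); [apply Ck|now apply CF, Hseg]. }
assert (HfI : RInt f a b = I).
{ apply is_RInt_unique. apply is_RInt_ext with (2 := HI).
  intros x Hx. apply (HF x (Hseg' x Hx)). }
(* By the differential equation of [k], this is the integral of [k'' F]. The integrations by parts
   then run from [k'' F] to [k' F'] and on to [k F''], so integrability is carried along. *)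
assert (H2 : is_RInt (fun x => scal (- L * k x - / (b - a)) (F x)) a b
  (plus (scal (- L) J) (scal (- / (b - a)) I))).
{ apply is_RInt_ext with
    (fun x => plus (scal (- L) (scal (k x) (F x))) (scal (- / (b - a)) (F x))).
  - intros x _. rewrite (scal_assoc (- L) (k x) (F x)).
    symmetry. exact (scal_distr_r (- L * k x) (- / (b - a)) (F x)).
  - apply (is_RInt_plus (V := V)); apply (is_RInt_scal (V := V)); assumption. }
assert (H1 := is_RInt_scal_derive_r k1 F (fun x => - L * k x - / (b - a)) F1 a b _
  (fun t _ => Hk1 t) (fun t Ht => proj1 (proj2 (proj2 (HF t (Hseg t Ht)))))
  (fun t _ => Ck2 t) (fun t Ht => CF1 t (Hseg t Ht)) H2).
assert (H0 := is_RInt_scal_derive_r k F1 k1 F2 a b _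
  (fun t _ => Hk t) (fun t Ht => proj1 (proj2 (proj2 (proj2 (HF t (Hseg t Ht))))))
  (fun t _ => Ck1 t) (fun t Ht => proj2 (proj2 (proj2 (proj2 (HF t (Hseg t Ht)))))) H1).
rewrite Hka, Hkb, Hk1a, Hk1b in H0.
rewrite (proj1 (HF a Ha)), (proj1 (HF b Hb)) in H0.
(* Adding [L] times the integral of [k F] completes the integrand and cancels [J]. *)
assert (H3 := is_RInt_plus _ _ a b _ _ H0 (is_RInt_scal _ a b L _ HJ)).
rewrite kernel_combine in H3. rewrite HfI.
apply is_RInt_ext with (2 := H3).
intros x Hx. destruct (HF x (Hseg' x Hx)) as [E0 [E2 _]].
rewrite E0, E2. symmetry.
exact (eq_trans (scal_distr_l (k x) (Derive2_on a b f x) (scal L (f x)))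
  (f_equal (plus _) (scal_scal_comm (k x) L (f x)))).
Qed.

(** * Estimates of the represented integral by the two norms *)

Lemma continuous_norm_clamp (a b : R) (h : R -> V) (x : R) :
  continuous_on (segment a b) h -> segment a b x ->
  continuous (fun y => norm (h (clamp a b y))) x.
Proof.
intros Hh Hx.
apply (continuous_comp (fun y => h (clamp a b y)) norm);
  [now apply continuous_clamp|exact (filterlim_norm (V := V) _)].
Qed.

(** Since [real] sends an infinite bound to 0, the least upper bound must be shown finite: the
    clamped norm is continuous and attains its maximum on the segment. *)
Lemma norm_le_norm_sup (a b : R) (h : R -> V) (x : R) :
  continuous_on (segment a b) h -> segment a b x -> norm (h x) <= norm_sup a b h.
Proof.
intros Hh Hx. unfold norm_sup.
set (S := fun r => exists t, segment a b t /\ r = norm (h t)).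
destruct (Lub_Rbar_correct S) as [Hub Hlub].
assert (Hin : S (norm (h x))) by (exists x; auto).
destruct (continuity_ab_maj (fun y => norm (h (clamp a b y))) a b) as [m [Hm Hms]].
{ destruct Hx; lra. }
{ intros c Hc. apply continuity_pt_filterlim. now apply continuous_norm_clamp. }
assert (Hle : Rbar_le (Lub_Rbar S) (norm (h m))).
{ apply Hlub. intros r [t [Ht ->]]. simpl.
  specialize (Hm t Ht). now rewrite !clamp_id in Hm. }
specialize (Hub _ Hin).
destruct (Lub_Rbar S) as [r| |]; simpl in *; tauto.
Qed.

Lemma is_RInt_norm_L1 (a b : R) (h : R -> V) :
  a < b -> continuous_on (segment a b) h ->
  is_RInt (fun t => norm (h t)) a b (norm_L1 a b h).
Proof.
intros Hab Hh. apply (RInt_correct (fun t => norm (h t))).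
apply ex_RInt_ext with (fun y => norm (h (clamp a b y))).
- rewrite Rmin_left, Rmax_right by lra. intros x Hx.
  rewrite clamp_id; [reflexivity|split; lra].
- apply (ex_RInt_continuous (V := R_CompleteNormedModule)).
  rewrite Rmin_left, Rmax_right by lra. intros x Hx.
  now apply continuous_norm_clamp.
Qed.

(** Hölder's inequality with the supremum taken on the kernel; [norm_RInt_scal_le_sup] exchanges the
    roles. *)
Lemma norm_RInt_scal_le_L1 (a b C : R) (k : R -> R) (h : R -> V) (l : V) :
  a < b -> continuous_on (segment a b) h ->
  (forall x, segment a b x -> Rabs (k x) <= C) ->
  is_RInt (fun x => scal (k x) (h x)) a b l -> norm l <= C * norm_L1 a b h.
Proof.
intros Hab Hh Hk Hl.
apply (norm_RInt_le (fun x => scal (k x) (h x)) (fun x => C * norm (h x)) a b);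
  [lra| |exact Hl|].
- intros x Hx. eapply Rle_trans; [apply (norm_scal (k x) (h x))|].
  apply Rmult_le_compat_r; [apply norm_ge_0|now apply Hk].
- apply (is_RInt_scal (fun t => norm (h t)) a b C), is_RInt_norm_L1; assumption.
Qed.

Lemma norm_RInt_scal_le_sup (a b A : R) (k : R -> R) (h : R -> V) (l : V) :
  a < b -> continuous_on (segment a b) h ->
  is_RInt (fun x => Rabs (k x)) a b A ->
  is_RInt (fun x => scal (k x) (h x)) a b l -> norm l <= A * norm_sup a b h.
Proof.
intros Hab Hh Hk Hl.
apply (norm_RInt_le (fun x => scal (k x) (h x))
         (fun x => norm_sup a b h * Rabs (k x)) a b); [lra| |exact Hl|].
- intros x Hx. eapply Rle_trans; [apply (norm_scal (k x) (h x))|].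
  rewrite (Rmult_comm (norm_sup a b h)).
  apply Rmult_le_compat_l; [apply Rabs_pos|now apply norm_le_norm_sup].
- rewrite Rmult_comm.
  apply (is_RInt_scal (fun t => Rabs (k t)) a b (norm_sup a b h)), Hk.
Qed.

Lemma C2_on_continuous_combination (a b L : R) (f : R -> V) :
  a < b -> C2_on a b f ->
  continuous_on (segment a b) (fun x => plus (Derive2_on a b f x) (scal L (f x))).
Proof.
intros Hab Hf.
destruct (C2_on_extension a b f Hab Hf) as [F [F1 [F2 HF]]].
apply continuous_on_ext with (fun x => plus (F2 x) (scal L (F x))).
- intros x Hx. destruct (HF x Hx) as [-> [-> _]]. reflexivity.
- apply continuous_on_forall. intros x Hx.
  destruct (HF x Hx) as [_ [_ [H1 [_ H2]]]].
  apply (continuous_plus F2 (fun x => scal L (F x))); [exact H2|].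
  apply (continuous_scal_r L F), (is_derive_continuous F x _ H1).
Qed.

End Extension.

(** * The integral of [|cos v - cos t|] over several periods *)

Lemma cos_add_mul_PI (x : R) (n : nat) : cos (x + INR n * PI) = (-1) ^ n * cos x.
Proof.
induction n as [|n IH]; [simpl; rewrite Rmult_0_l, Rplus_0_r; ring|].
rewrite S_INR. replace (x + (INR n + 1) * PI) with (x + INR n * PI + PI) by ring.
rewrite neg_cos, IH. simpl. ring.
Qed.

Lemma sin_add_mul_PI (x : R) (n : nat) : sin (x + INR n * PI) = (-1) ^ n * sin x.
Proof.
induction n as [|n IH]; [simpl; rewrite Rmult_0_l, Rplus_0_r; ring|].
rewrite S_INR. replace (x + (INR n + 1) * PI) with (x + INR n * PI + PI) by ring.
rewrite neg_sin, IH. simpl. ring.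
Qed.

Lemma cos_ge_cos (t w : R) : t <= PI -> - t <= w <= t -> cos t <= cos w.
Proof.
intros Ht Hw.
destruct (Rle_dec 0 w) as [H|H].
- apply cos_decr_1; lra.
- rewrite <- (cos_neg w). apply cos_decr_1; lra.
Qed.

Lemma cos_le_cos (t w : R) : 0 <= t -> t <= w <= 2 * PI - t -> cos w <= cos t.
Proof.
intros Ht Hw.
destruct (Rle_dec w PI) as [H|H].
- apply cos_decr_1; lra.
- rewrite <- (cos_neg w).
  replace (cos (- w)) with (cos (2 * PI - w)).
  + apply cos_decr_1; lra.
  + rewrite <- (cos_period (- w) 1). f_equal. simpl. ring.
Qed.

Lemma is_RInt_cos_minus (c l r : R) :
  is_RInt (fun v => cos v - c) l r ((sin r - c * r) - (sin l - c * l)).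
Proof.
apply (is_RInt_derive (fun v => sin v - c * v) (fun v => cos v - c)).
- intros x _. auto_derive; [exact I|ring].
- intros x _. apply (ex_derive_continuous (fun v => cos v - c)). auto_derive. exact I.
Qed.

(* [cos v - cos t] changes sign exactly at the points [2 j PI - t] and [2 j PI + t]. *)
Lemma is_RInt_abs_cos_minus (t : R) (m : nat) :
  0 <= t <= PI ->
  is_RInt (fun v => Rabs (cos v - cos t)) (- t) (2 * INR m * PI + t)
    (2 * (INR m + 1) * (sin t - t * cos t)
     + 2 * INR m * (sin t + (PI - t) * cos t)).
Proof.
intros Ht.
assert (Hper : forall (j : nat) x, cos (x - 2 * INR j * PI) = cos x).
{ intros j x. rewrite <- (cos_period (x - 2 * INR j * PI) j). f_equal. ring. }
assert (Hcos : forall j : nat, cos (2 * INR j * PI + t) = cos t).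
{ intros j. rewrite <- (Hper j). f_equal. ring. }
assert (Hsin : forall (j : nat) x, sin (2 * INR j * PI + x) = sin x).
{ intros j x. rewrite <- (sin_period x j). f_equal. ring. }
assert (Hpos : forall j : nat,
  is_RInt (fun v => Rabs (cos v - cos t)) (2 * INR j * PI - t) (2 * INR j * PI + t)
    (2 * (sin t - t * cos t))).
{ intros j.
  apply is_RInt_ext with (fun v => cos v - cos t).
  - rewrite Rmin_left, Rmax_right by lra. intros x Hx.
    rewrite Rabs_pos_eq; [reflexivity|].
    rewrite <- (Hper j x).
    pose proof (cos_ge_cos t (x - 2 * INR j * PI) ltac:(lra) ltac:(lra)). lra.
  - replace (2 * (sin t - t * cos t)) with
      ((sin (2 * INR j * PI + t) - cos t * (2 * INR j * PI + t))
       - (sin (2 * INR j * PI + - t) - cos t * (2 * INR j * PI - t)))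
      by (rewrite !Hsin, sin_neg; ring).
    apply is_RInt_cos_minus. }
(* The base case is the single arc around 0 where [cos v >= cos t]. Each further period appends an
   arc where [cos v <= cos t] and then one of the first kind, hence the counts [m + 1] and [m]. *)
induction m as [|m IH].
- specialize (Hpos 0%nat). simpl INR in *.
  replace (2 * 0 * PI - t) with (- t) in Hpos by ring.
  replace (2 * (0 + 1) * (sin t - t * cos t) + 2 * 0 * (sin t + (PI - t) * cos t))
    with (2 * (sin t - t * cos t)) by ring.
  exact Hpos.
- assert (Hneg : is_RInt (fun v => Rabs (cos v - cos t))
    (2 * INR m * PI + t) (2 * INR (S m) * PI - t) (2 * (sin t + (PI - t) * cos t))).
  { assert (HS : 2 * INR (S m) * PI = 2 * INR m * PI + 2 * PI) by (rewrite S_INR; ring).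
    apply is_RInt_ext with (fun v => - (cos v - cos t)).
    - rewrite Rmin_left, Rmax_right by lra. intros x Hx.
      rewrite Rabs_left1; [reflexivity|].
      rewrite <- (Hper m x).
      pose proof (cos_le_cos t (x - 2 * INR m * PI) ltac:(lra) ltac:(lra)). lra.
    - replace (2 * (sin t + (PI - t) * cos t)) with
        (- ((sin (2 * INR (S m) * PI + - t) - cos t * (2 * INR (S m) * PI - t))
            - (sin (2 * INR m * PI + t) - cos t * (2 * INR m * PI + t))))
        by (rewrite !Hsin, sin_neg, HS; ring).
      apply (is_RInt_opp (fun v => cos v - cos t)), is_RInt_cos_minus. }
  pose proof (is_RInt_Chasles _ _ _ _ _ _
    (is_RInt_Chasles _ _ _ _ _ _ IH Hneg) (Hpos (S m))) as H.
  unfold plus in H; simpl in H.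
  match type of H with is_RInt _ _ _ ?v =>
    replace v with (2 * (INR (S m) + 1) * (sin t - t * cos t)
     + 2 * INR (S m) * (sin t + (PI - t) * cos t)) in H by (rewrite S_INR; ring) end.
  exact H.
Qed.

(** * The fixed points of the tangent and the oscillating kernel for [n > 0] *)

Lemma tau_decomposition (n : nat) :
  (0 < n)%nat ->
  exists t : R, 0 < t < PI / 2 /\ tau (Z.of_nat n) = t + INR n * PI /\
    sin t = tau (Z.of_nat n) * cos t.
Proof.
intros Hn. pose proof PI_RGT_0 as HPI.
destruct (tau_spec (Z.of_nat n)) as [Hb Ht].
rewrite <- INR_IZR_INZ in Hb.
set (v := tau (Z.of_nat n)) in *.
assert (H1 : 1 <= INR n) by (apply (le_INR 1); lia).
exists (v - INR n * PI).
set (t := v - INR n * PI).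
assert (Hv : v = t + INR n * PI) by (unfold t; ring).
assert (Hvpos : 0 < v) by nra.
(* The defining interval of [tau] gives [|t| < PI / 2]. Periodicity of the tangent then yields
   [tan t = v > 0], which forces [t > 0]. *)
assert (Hct : 0 < cos t) by (apply cos_gt_0; unfold t; lra).
assert (Hst : sin t = v * cos t).
{ unfold tan in Ht. rewrite Hv in Ht at 1 2.
  rewrite sin_add_mul_PI, cos_add_mul_PI in Ht.
  rewrite <- Ht. field. split; [lra|apply pow_nonzero; lra]. }
assert (Htpos : 0 < t).
{ apply Rnot_le_lt. intros Hle.
  assert (0 <= sin (- t)) by (apply sin_ge_0; unfold t in *; lra).
  rewrite sin_neg in H. nra. }
repeat split; [exact Htpos|unfold t; lra|exact Hv|exact Hst].
Qed.

Lemma Rabs_pow_m1_mult (n : nat) (x : R) : 0 <= x -> Rabs ((-1) ^ n * x) = x.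
Proof.
intros Hx. rewrite Rabs_mult, pow_1_abs, Rmult_1_l. now apply Rabs_pos_eq.
Qed.

Section Kernel.

Context (a b : R) (n : nat).
Context (Hab : a < b) (Hn : (0 < n)%nat).

Let tau_n := tau (Z.of_nat n).
Let lambda_n := 2 * tau_n / (b - a).

(** At the ends the argument of the cosine is [- tau_n] and [tau_n]; the denominator normalises the
    slopes there to 1/2 and -1/2. *)
Definition oscillating_kernel (x : R) : R :=
  (cos (lambda_n * (x - (a + b) / 2)) - cos tau_n) / (2 * lambda_n * sin tau_n).

(** Reduction to the acute angle [t]: the factor [(-1) ^ n] disappears under absolute values. *)
Lemma tau_signs : exists t : R,
  0 < t < PI / 2 /\ tau_n = t + INR n * PI /\ 0 < tau_n /\
  sin t = tau_n * cos t /\ 0 < cos t /\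
  cos tau_n = (-1) ^ n * cos t /\ sin tau_n = (-1) ^ n * sin t /\
  Rabs (cos tau_n) = cos t /\ Rabs (sin tau_n) = sin t.
Proof.
destruct (tau_decomposition n Hn) as [t [Ht [Htau Hsin]]].
fold tau_n in Htau, Hsin.
pose proof PI_RGT_0. pose proof (pos_INR n).
assert (Hc : 0 < cos t) by (apply cos_gt_0; lra).
assert (Hs : 0 < sin t) by (apply sin_gt_0; lra).
assert (Hpos : 0 < tau_n) by nra.
exists t. repeat split; try assumption; try apply Ht.
- rewrite Htau. apply cos_add_mul_PI.
- rewrite Htau. apply sin_add_mul_PI.
- rewrite Htau, cos_add_mul_PI. apply Rabs_pow_m1_mult; lra.
- rewrite Htau, sin_add_mul_PI. apply Rabs_pow_m1_mult; lra.
Qed.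

Lemma lambda_pos : 0 < lambda_n.
Proof.
destruct tau_signs as [t [_ [_ [H _]]]].
apply Rdiv_lt_0_compat; lra.
Qed.

Lemma sin_tau_neq_0 : sin tau_n <> 0.
Proof.
destruct tau_signs as [t [_ [_ [H1 [H2 [H3 [_ [_ [_ H]]]]]]]]].
intros H0. rewrite H0, Rabs_R0 in H. nra.
Qed.

Lemma sin_tau : sin tau_n = tau_n * cos tau_n.
Proof.
destruct tau_signs as [t [_ [_ [H1 [H2 [H3 [-> [-> _]]]]]]]]. rewrite H2. ring.
Qed.

Lemma oscillating_kernel_ends : oscillating_kernel a = 0 /\ oscillating_kernel b = 0.
Proof.
unfold oscillating_kernel.
replace (lambda_n * (a - (a + b) / 2)) with (- tau_n) by (unfold lambda_n; field; lra).
replace (lambda_n * (b - (a + b) / 2)) with tau_n by (unfold lambda_n; field; lra).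
rewrite cos_neg. unfold Rdiv. rewrite Rminus_diag. lra.
Qed.

Definition oscillating_kernel' (x : R) : R :=
  - sin (lambda_n * (x - (a + b) / 2)) / (2 * sin tau_n).

Lemma oscillating_kernel'_ends :
  oscillating_kernel' a = / 2 /\ oscillating_kernel' b = - / 2.
Proof.
pose proof sin_tau_neq_0.
unfold oscillating_kernel'.
replace (lambda_n * (a - (a + b) / 2)) with (- tau_n) by (unfold lambda_n; field; lra).
replace (lambda_n * (b - (a + b) / 2)) with tau_n by (unfold lambda_n; field; lra).
rewrite sin_neg. split; field; assumption.
Qed.

Lemma is_derive_oscillating_kernel (x : R) :
  is_derive oscillating_kernel x (oscillating_kernel' x).
Proof.
pose proof sin_tau_neq_0. pose proof lambda_pos.
unfold oscillating_kernel, oscillating_kernel'.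
auto_derive; [exact I|].
change (x + - ((a + b) / 2)) with (x - (a + b) / 2).
field. split; [assumption|lra].
Qed.

Lemma is_derive_oscillating_kernel' (x : R) :
  is_derive oscillating_kernel' x
    (- lambda_n ^ 2 * oscillating_kernel x - / (b - a)).
Proof.
pose proof sin_tau_neq_0 as H1. pose proof lambda_pos.
(* The fixed-point equation enters here: [sin tau_n = tau_n * cos tau_n] turns the constant term of
   the differential equation into exactly [/ (b - a)]. *)
assert (Hc : / (b - a) = lambda_n * cos tau_n / (2 * sin tau_n)).
{ rewrite sin_tau in H1 |- *. unfold lambda_n. field.
  repeat split; try lra; intros H0; apply H1; rewrite H0; ring. }
rewrite Hc.
unfold oscillating_kernel, oscillating_kernel'.
auto_derive; [exact I|].
change (x + - ((a + b) / 2)) with (x - (a + b) / 2).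
field. split; [assumption|lra].
Qed.

Lemma abs_oscillating_kernel (x : R) :
  Rabs (oscillating_kernel x)
  = Rabs (cos (lambda_n * (x - (a + b) / 2)) - cos tau_n)
    / (2 * lambda_n * Rabs (sin tau_n)).
Proof.
pose proof lambda_pos. unfold oscillating_kernel, Rdiv at 1.
rewrite Rabs_mult, Rabs_inv. unfold Rdiv. do 2 f_equal.
rewrite !Rabs_mult, (Rabs_pos_eq 2), (Rabs_pos_eq lambda_n) by lra. reflexivity.
Qed.

(** Triangle inequality and [|cos| <= 1], with [2 * lambda_n] written as [4 * tau_n / (b - a)]. *)
Lemma oscillating_kernel_bound (x : R) :
  Rabs (oscillating_kernel x)
  <= (1 + Rabs (cos tau_n)) / (4 * tau_n * Rabs (sin tau_n)) * (b - a).
Proof.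
pose proof sin_tau_neq_0 as H1. pose proof lambda_pos as Hl.
destruct tau_signs as [t [_ [_ [Hpos _]]]].
assert (Hs : 0 < Rabs (sin tau_n)) by (apply Rabs_pos_lt; exact H1).
replace ((1 + Rabs (cos tau_n)) / (4 * tau_n * Rabs (sin tau_n)) * (b - a))
  with ((1 + Rabs (cos tau_n)) / (2 * lambda_n * Rabs (sin tau_n)))
  by (unfold lambda_n; field; repeat split; lra).
rewrite abs_oscillating_kernel.
apply Rmult_le_compat_r.
- apply Rlt_le, Rinv_0_lt_compat, Rmult_lt_0_compat; [lra|exact Hs].
- eapply Rle_trans; [apply Rabs_triang|]. rewrite Rabs_Ropp.
  apply Rplus_le_compat_r, Rabs_le, COS_bound.
Qed.

Lemma is_RInt_abs_oscillating_kernel :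
  is_RInt (fun x => Rabs (oscillating_kernel x)) a b
    ((INR n + 1) * INR n * PI / (2 * tau_n ^ 3) * (b - a) ^ 2).
Proof.
pose proof lambda_pos as Hl. pose proof PI_RGT_0.
destruct tau_signs as [t [Ht [Htau [Hpos [Hsin [Hct [Hc [_ [_ Has]]]]]]]]].
assert (Hst : 0 < sin t) by (rewrite Hsin; nra).
assert (Hct' : cos t = (-1) ^ n * cos tau_n).
{ rewrite Hc, <- Rmult_assoc, <- pow_add.
  replace (n + n)%nat with (2 * n)%nat by lia. rewrite pow_1_even. ring. }
pose proof (is_RInt_abs_cos_minus t n ltac:(lra)) as H0.
(* Both limits are rewritten as images of [a] and [b] under the affine substitution, the form that
   [is_RInt_comp_lin] expects. *)
replace (- t) with (lambda_n * a + (INR n * PI - lambda_n * ((a + b) / 2))) in H0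
  by (rewrite <- (Rplus_minus_r t (INR n * PI)), <- Htau; unfold lambda_n; field; lra).
replace (2 * INR n * PI + t)
  with (lambda_n * b + (INR n * PI - lambda_n * ((a + b) / 2))) in H0
  by (replace (2 * INR n * PI + t) with (INR n * PI + tau_n) by (rewrite Htau; ring);
      unfold lambda_n; field; lra).
apply (is_RInt_comp_lin (V := R_NormedModule)) in H0.
(* One factor [lambda_n] undoes the Jacobian of the substitution; the rest is the normalisation of
   the kernel. *)
apply (is_RInt_scal _ _ _ (/ (2 * lambda_n ^ 2 * sin t))) in H0.
match type of H0 with is_RInt _ _ _ ?v =>
  replace v with ((INR n + 1) * INR n * PI / (2 * tau_n ^ 3) * (b - a) ^ 2) in H0 end.
- apply is_RInt_ext with (2 := H0). intros x _.
  unfold scal; simpl; unfold mult; simpl.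
  replace (lambda_n * x + (INR n * PI - lambda_n * ((a + b) / 2)))
    with (lambda_n * (x - (a + b) / 2) + INR n * PI) by ring.
  rewrite cos_add_mul_PI, abs_oscillating_kernel, Has.
  rewrite Hct', <- Rmult_minus_distr_l, Rabs_mult, pow_1_abs. field. lra.
- unfold scal; simpl; unfold mult; simpl.
  (* Since [sin t = tau_n * cos t] and [tau_n - t = n PI], the two groups of arcs contribute
     equally, [2 n (n + 1) PI cos t] each before scaling. Eliminating [PI] and [sin t] leaves this
     to [field]. *)
  replace PI with ((tau_n - t) / INR n) by (rewrite Htau; field; apply not_0_INR; lia).
  rewrite Hsin. unfold lambda_n. field.
  repeat split; try lra. apply not_0_INR; lia.
Qed.

End Kernel.

(** * The quadratic kernel for [n = 0] *)

Lemma is_RInt_quadratic (a b : R) :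
  a < b ->
  is_RInt (fun x => Rabs ((x - a) * (b - x) / (2 * (b - a)))) a b
    (/ 12 * (b - a) ^ 2).
Proof.
intros Hab.
apply is_RInt_ext with (fun x => (x - a) * (b - x) / (2 * (b - a))).
- rewrite Rmin_left, Rmax_right by lra. intros x Hx.
  rewrite Rabs_pos_eq; [reflexivity|].
  apply Rlt_le, Rdiv_lt_0_compat; [apply Rmult_lt_0_compat|]; lra.
(* The antiderivative comes from [(x - a) * (b - x) = (b - a) * (x - a) - (x - a) ^ 2]. *)
- set (P := fun x => ((b - a) * (x - a) ^ 2 / 2 - (x - a) ^ 3 / 3) / (2 * (b - a))).
  replace (/ 12 * (b - a) ^ 2) with (minus (P b) (P a))
    by (unfold minus, plus, opp, P; simpl; field; lra).
  apply (is_RInt_derive P).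
  + intros x _. unfold P. auto_derive; [exact I|]. field. lra.
  + intros x _. apply (ex_derive_continuous (fun x => (x - a) * (b - x) / (2 * (b - a)))).
    auto_derive. exact I.
Qed.

Lemma quadratic_bound (a b x : R) :
  a < b -> segment a b x ->
  Rabs ((x - a) * (b - x) / (2 * (b - a))) <= / 8 * (b - a).
Proof.
intros Hab [H1 H2].
rewrite Rabs_pos_eq.
- apply Rmult_le_reg_r with (2 * (b - a)); [lra|].
  unfold Rdiv. rewrite Rmult_assoc, Rinv_l by lra.
  (* Arithmetic-geometric mean: [4 (x - a) (b - x)] is [(b - a) ^ 2] minus this square. *)
  pose proof (pow2_ge_0 ((x - a) - (b - x))). nra.
- apply Rdiv_le_0_compat; [apply Rmult_le_pos|]; lra.
Qed.

Theorem theorem4p6 :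
  forall (K : RorC) (n : nat) (a b : R), a < b ->
  let tau_n := tau (Z.of_nat n) in
  let lambda_n := 2 * tau_n / (b - a) in
  forall f : R -> scalars K, C2_on a b f ->
  let f'' := Derive2_on a b f in
  let g := fun x => plus (f'' x) (scal (lambda_n ^ 2) (f x)) in
  let E := norm (minus (scal (/ 2) (plus (f a) (f b)))
                       (scal (/ (b - a)) (RInt f a b))) in
  (n = 0%nat ->
     E <= / 12 * (b - a) ^ 2 * norm_sup a b f'' /\
     E <= / 8 * (b - a) * norm_L1 a b f'') /\
  ((0 < n)%nat ->
     E <= (INR n + 1) * INR n * PI / (2 * tau_n ^ 3) * (b - a) ^ 2
          * norm_sup a b g /\
     E <= (1 + Rabs (cos tau_n)) / (4 * tau_n * Rabs (sin tau_n)) * (b - a)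
          * norm_L1 a b g).
Proof.
intros K n a b Hab tau_n lambda_n f Hf f'' g E.
split; intros Hn.
- assert (Hf2 : continuous_on (segment a b) f'') by apply Hf.
  assert (HE : is_RInt (fun x => scal ((x - a) * (b - x) / (2 * (b - a))) (f'' x)) a b
    (minus (scal (/ 2) (plus (f a) (f b))) (scal (/ (b - a)) (RInt f a b)))).
  (* The quadratic kernel solves the kernel equation with [L = 0]; the null term [scal 0 (f x)] is
     inserted to match the general representation. *)
  { apply is_RInt_ext with
      (fun x => scal ((x - a) * (b - x) / (2 * (b - a))) (plus (f'' x) (scal 0 (f x)))).
    - intros x _. apply (f_equal (scal _)).
      exact (eq_trans (f_equal (plus (f'' x)) (scal_R0 (f x))) (plus_zero_r (f'' x))).
    - apply kernel_representation with
        (k1 := fun x => (a + b - 2 * x) / (2 * (b - a)));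
        [exact Hab|exact Hf| | | | | |]; try (intros x; auto_derive; [exact I|]);
        field; lra. }
  split.
  + apply (norm_RInt_scal_le_sup a b _ _ f'' _ Hab Hf2 (is_RInt_quadratic a b Hab) HE).
  + apply (norm_RInt_scal_le_L1 a b _ _ f'' _ Hab Hf2
             (fun x => quadratic_bound a b x Hab) HE).
- assert (Hg : continuous_on (segment a b) g)
    by exact (C2_on_continuous_combination a b _ f Hab Hf).
  assert (HE := kernel_representation a b (lambda_n ^ 2) _ _ f Hab Hf
    (is_derive_oscillating_kernel a b n Hab Hn)
    (is_derive_oscillating_kernel' a b n Hab Hn)
    (proj1 (oscillating_kernel_ends a b n Hab))
    (proj2 (oscillating_kernel_ends a b n Hab))
    (proj1 (oscillating_kernel'_ends a b n Hab Hn))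
    (proj2 (oscillating_kernel'_ends a b n Hab Hn))).
  split.
  + apply (norm_RInt_scal_le_sup a b _ _ g _ Hab Hg
             (is_RInt_abs_oscillating_kernel a b n Hab Hn) HE).
  + apply (norm_RInt_scal_le_L1 a b _ _ g _ Hab Hg
             (fun x _ => oscillating_kernel_bound a b n Hab Hn x) HE).
Qed.
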